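(* Let $(M,\phi_\alpha,\xi_\alpha,\eta_\alpha,g)$, $\alpha\in\{1,2,3\}$, be a 3-quasi-Sasakian manifold, and let $c\in\mathbb{R}$ be the constant such that $[\xi_\alpha,\xi_\beta]=c\,\xi_\gamma$ for every even permutation $(\alpha,\beta,\gamma)$ of $\{1,2,3\}$. Then for each $\alpha\in\{1,2,3\}$ and all vector fields $X,Y$ on $M$, $$R_{XY}\xi_\alpha=\frac{c^2}{4}\left(\eta_{\alpha}(X)\,\psi_{\alpha}^{2}Y - \eta_{\alpha}(Y)\,\psi_{\alpha}^{2}X\right),$$ where, if $M$ has rank $1$ (equivalently $c=0$, i.e. $M$ is 3-cosymplectic), the right-hand side is understood to be $0$.
   Context: All manifolds are smooth and connected. An almost contact metric structure $(\phi,\xi,\eta,g)$ on $M$ consists of a $(1,1)$-tensor field $\phi$, a vector field $\xi$, a 1-form $\eta$ and a Riemannian metric $g$ with $\phi^2=-I+\eta\otimes\xi$, $\eta(\xi)=1$, $g(\phi X,\phi Y)=g(X,Y)-\eta(X)\eta(Y)$. Convention: $d\eta(X,Y)=X(\eta(Y))-Y(\eta(X))-\eta([X,Y])$. The structure is normal if $[\phi,\phi]+d\eta\otimes\xi=0$, where $[\phi,\phi]$ is the Nijenhuis torsion. Put $\Phi(X,Y)=g(X,\phi Y)$. The structure is quasi-Sasakian if it is normal and $d\Phi=0$; cosymplectic if in addition $d\eta=0$. A quasi-Sasakian manifold has rank $2p+1$ if $\eta\wedge(d\eta)^p\neq0$ and $(d\eta)^{p+1}=0$ on $M$. A 3-quasi-Sasakian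 manifold is a manifold of dimension $4n+3$ with three quasi-Sasakian structures $(\phi_\alpha,\xi_\alpha,\eta_\alpha,g)$, $\alpha\in\{1,2,3\}$, with the same metric $g$, such that for every even permutation $(\alpha,\beta,\gamma)$ of $\{1,2,3\}$: $\phi_\gamma=\phi_\alpha\phi_\beta-\eta_\beta\otimes\xi_\alpha=-\phi_\beta\phi_\alpha+\eta_\alpha\otimes\xi_\beta$, $\xi_\gamma=\phi_\alpha\xi_\beta=-\phi_\beta\xi_\alpha$, $\eta_\gamma=\eta_\alpha\circ\phi_\beta=-\eta_\beta\circ\phi_\alpha$. It is 3-cosymplectic if each of the three structures is cosymplectic. It is known that there is a constant $c\in\mathbb{R}$ with $[\xi_\alpha,\xi_\beta]=c\,\xi_\gamma$ for every even permutation; that $\eta_1,\eta_2,\eta_3$ have the same rank (the rank of $M$); that the rank is $1$ if and only if $M$ is 3-cosymplectic if and only if $c=0$; and that otherwise the rank is $4l+3$ for some $l\le n$. Let $\mathcal{H}=\bigcap_{\alpha}\ker\eta_\alpha$. For rank $4l+3$, with $m=n-l$, put $\mathcal{E}^{4m}=\{X\in\mathcal{H} : i_Xd\eta_\alpha=0 \text{ for } \alpha=1,2,3\}$ and $\mathcal{E}^{4l+3}=(\mathcal{E}^{4m})^\perp$. Define the $(1,1)$-tensor $\psi_\alpha$ by $\psi_\alpha=\phi_\alpha$ on $\mathcal{E}^{4l+3}$ and $\psi_\alpha=0$ on $\mathcal{E}^{4m}$. $\nabla$ is the Levi-Civita connection of $g$ and $R_{XY}=\nabla_X\nabla_Y-\nabla_Y\nabla_X-\nabla_{[X,Y]}$.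 *)

(* Defs.v *)
From HB Require Import structures.
From mathcomp Require Import all_boot all_order all_algebra all_fingroup.
From mathcomp Require Import ring.
From mathcomp Require Import all_classical all_reals all_analysis.

Set Implicit Arguments.
Unset Strict Implicit.
Unset Printing Implicit Defensive.

Import Order.TTheory GRing.Theory Num.Theory numFieldNormedType.Exports.

Local Open Scope classical_set_scope.
Local Open Scope ring_scope.

Section Ck.
Variables (R : realType) (d : nat).
Implicit Types (U : set 'rV[R]_d) (f g : 'rV[R]_d -> R).

(* The class C^k on U; only meaningful when U is open. *)
Fixpoint Ck (k : nat) U f : Prop :=
  if k is k'.+1 then
    {in U, continuous f} /\
    forall i : 'I_d, (forall x, U x -> derivable f x 'e_i) /\
                     Ck k' U (fun x => 'D_'e_i f x)
  else {in U, continuous f}.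

Definition smooth_on U f := forall k, Ck k U f.

Lemma Ck_continuous k U f : Ck k U f -> {in U, continuous f}.
Proof. by case: k => [//|k] []. Qed.

Lemma CkS k U f : Ck k.+1 U f -> Ck k U f.
Proof.
elim: k f => [f []//|k IH f [fc fD]]; split=> // i.
by have [fi Di] := fD i; split=> //; exact: IH.
Qed.

Lemma eq_Ck k U f g : open U -> {in U, f =1 g} -> Ck k U f -> Ck k U g.
Proof.
move=> Uo; have nearU f' g' x : {in U, f' =1 g'} -> U x ->
    \forall y \near x, f' y = g' y.
  move=> fg Ux; apply: filterS (open_nbhs_nbhs (conj Uo Ux)) => y Uy.
  by apply: fg; rewrite inE.
have eqc f' g' : {in U, f' =1 g'} -> {in U, continuous f'} ->
    {in U, continuous g'}.
  move=> fg f'c x xU; have Ux : U x by rewrite inE in xU.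
  rewrite /continuous_at -(fg _ xU).
  have e0 := nearU _ _ _ fg Ux.
  exact: cvg_trans (near_eq_cvg e0) (f'c x xU).
elim: k f g => [f g fg|k IH f g fg [fc fD]] /=; first exact: eqc.
split=> [|i]; first exact: eqc fc.
have [fi Di] := fD i; split=> [x Ux|].
  have e0 := nearU _ _ _ fg Ux.
  exact: near_eq_derivable e0 (fi x Ux).
apply: IH Di => x xU; have Ux : U x by rewrite inE in xU.
have e0 := nearU _ _ _ fg Ux.
exact: near_eq_derive e0.
Qed.

Lemma Ck_cst k U (a : R) : open U -> Ck k U (cst a).
Proof.
move=> Uo; elim: k a => [|k IH] a /=; first by move=> x _; exact: cst_continuous.
split=> [x _|i]; first exact: cst_continuous.
split=> [x _|]; first exact: derivable_cst.
by apply: (eq_Ck Uo _ (IH 0)) => x _ /=; rewrite derive_cst.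
Qed.

Lemma CkD k U f g : open U -> Ck k U f -> Ck k U g -> Ck k U (f \+ g).
Proof.
move=> Uo; elim: k f g => [f g fc gc x xU|k IH f g [fc fD] [gc gD]] /=.
  by apply: continuousD; [exact: fc|exact: gc].
split=> [x xU|i]; first by apply: continuousD; [exact: fc|exact: gc].
have [[fi Df] [gi Dg]] := (fD i, gD i); split=> [x Ux|].
  by apply: derivableD; [exact: fi|exact: gi].
apply: (eq_Ck Uo _ (IH _ _ Df Dg)) => x; rewrite inE => Ux /=.
by rewrite deriveD //; [exact: fi|exact: gi].
Qed.

Lemma CkM k U f g : open U -> Ck k U f -> Ck k U g -> Ck k U (f \* g).
Proof.
move=> Uo; elim: k f g => [f g fc gc x xU|k IH f g fS gS].
  by apply: continuousM; [exact: fc|exact: gc].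
have [fk gk] := (CkS fS, CkS gS).
have [[fc fD] [gc gD]] := (fS, gS); split=> [x xU|i].
  by apply: continuousM; [exact: fc|exact: gc].
have [[fi Df] [gi Dg]] := (fD i, gD i); split=> [x Ux|].
  by apply: derivableM; [exact: fi|exact: gi].
apply: (eq_Ck Uo _ (CkD Uo (IH _ _ fk Dg) (IH _ _ gk Df))) => x.
by rewrite inE => Ux /=; rewrite deriveM //; [exact: fi|exact: gi].
Qed.

End Ck.

(* chart_map and chart_inv are total functions that only matter on chart_dom
   and chart_cod respectively. *)
Record chart (R : realType) (d : nat) (T : topologicalType) := Chart {
  chart_dom : set T;
  chart_cod : set 'rV[R]_d;
  chart_map : T -> 'rV[R]_d;
  chart_inv : 'rV[R]_d -> T;
  open_chart_dom : open chart_dom;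
  open_chart_cod : open chart_cod;
  chart_map_fun : set_fun chart_dom chart_cod chart_map;
  chart_inv_fun : set_fun chart_cod chart_dom chart_inv;
  chart_mapK : {in chart_dom, cancel chart_map chart_inv};
  chart_invK : {in chart_cod, cancel chart_inv chart_map};
  chart_map_continuous : {in chart_dom, continuous chart_map};
  chart_inv_continuous : {in chart_cod, continuous chart_inv} }.

Arguments open_chart_dom {R d T} _.
Arguments open_chart_cod {R d T} _.

(* The atlas need not be maximal: a function is smooth for an atlas iff it is
   smooth for the maximal atlas that contains it. *)
Record manifold (R : realType) (d : nat) := Manifold {
  manifold_carrier :> topologicalType;
  atlas : set (chart R d manifold_carrier);
  manifold_hausdorff : hausdorff_space manifold_carrier;
  manifold_second_countable : @second_countable manifold_carrier;
  manifold_connected : connected [set: manifold_carrier];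
  manifold_nonempty : [set: manifold_carrier] !=set0;
  atlas_cover : forall x : manifold_carrier,
    exists2 u, atlas u & chart_dom u x;
  atlas_compatible : forall u v, atlas u -> atlas v -> forall i : 'I_d,
    smooth_on (chart_cod u `&` chart_inv u @^-1` chart_dom v)
              (fun y => chart_map v (chart_inv u y) 0 i) }.

Arguments atlas {R d} m _.

Section SmoothFunctions.
Variables (R : realType) (d : nat) (M : manifold R d).

Definition smooth (f : M -> R) := forall u, atlas M u ->
  smooth_on (chart_cod u) (f \o chart_inv u).

Definition smooth_pred : {pred M -> R} := fun f => `[< smooth f >].

Record smoothfun := SmoothFun {
  smoothfun_val :> M -> R;
  smoothfunP : smoothfun_val \in smooth_pred }.

HB.instance Definition _ := [isSub for smoothfun_val].
HB.instance Definition _ := [Choice of smoothfun by <:].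

Lemma smooth_cst (a : R) : smooth (cst a).
Proof. by move=> u _ k; apply: Ck_cst; exact: open_chart_cod. Qed.

Lemma smoothD f g : smooth f -> smooth g -> smooth (f + g).
Proof.
move=> fs gs u uM k; have := CkD (open_chart_cod u) (fs u uM k) (gs u uM k).
exact.
Qed.

Lemma smoothM f g : smooth f -> smooth g -> smooth (f * g).
Proof.
move=> fs gs u uM k; have := CkM (open_chart_cod u) (fs u uM k) (gs u uM k).
exact.
Qed.

Lemma smoothZ (a : R) f : smooth f -> smooth (a *: f).
Proof. by move=> fs; exact: smoothM (smooth_cst a) fs. Qed.

Lemma smooth_subring_closed : subring_closed smooth_pred.
Proof.
split=> [|f g /asboolP fs /asboolP gs|f g /asboolP fs /asboolP gs].
- by apply/asboolP; exact: smooth_cst.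
- by apply/asboolP/smoothD => //; rewrite -scaleN1r; exact: smoothZ.
- by apply/asboolP; exact: smoothM.
Qed.

Lemma smooth_submod_closed : submod_closed smooth_pred.
Proof.
split=> [|a f g /asboolP fs /asboolP gs]; first by apply/asboolP/smooth_cst.
by apply/asboolP/smoothD => //; exact: smoothZ.
Qed.

HB.instance Definition _ := GRing.SubChoice_isSubComPzRing.Build
  (M -> R) smooth_pred smoothfun smooth_subring_closed.
HB.instance Definition _ := GRing.SubZmodule_isSubLmodule.Build
  R (M -> R) smooth_pred smoothfun smooth_submod_closed.

Lemma smoothfun_oner_neq0 : (1 : smoothfun) != 0.
Proof.
have [x _] := manifold_nonempty M; apply/eqP => /(congr1 (fun f => val f x)).
by move/eqP; rewrite oner_eq0.
Qed.
HB.instance Definition _ :=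
  GRing.PzSemiRing_isNonZero.Build smoothfun smoothfun_oner_neq0.

Lemma smoothfun_scalerAl (a : R) (f g : smoothfun) : a *: (f * g) = a *: f * g.
Proof. by apply/val_inj/funext => x; exact: mulrA. Qed.
HB.instance Definition _ :=
  GRing.Lmodule_isLalgebra.Build R smoothfun smoothfun_scalerAl.
HB.instance Definition _ := GRing.Lalgebra_isComAlgebra.Build R smoothfun.

End SmoothFunctions.

Section VectorFields.
Variables (R : realType) (d : nat) (M : manifold R d).
Local Notation C := (smoothfun M).

Definition derivation (D : C -> C) : Prop :=
  (forall (a : R) (f g : C), D (a *: f + g) = a *: D f + D g) /\
  (forall f g : C, D (f * g) = f * D g + g * D f).

(* The codomain is the regular module C^o, so that the functions C -> C^o form
   a C-module. *)
Definition derivation_pred : {pred C -> C^o} := fun D => `[< derivation D >].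

Record vfield := VField {
  vfield_val :> C -> C^o;
  vfieldP : vfield_val \in derivation_pred }.

HB.instance Definition _ := [isSub for vfield_val].
HB.instance Definition _ := [Choice of vfield by <:].

Lemma derivation_submod_closed : submod_closed derivation_pred.
Proof.
split=> [|h X Y /asboolP[Xl XM] /asboolP[Yl YM]]; apply/asboolP; split.
- by move=> a f g; rewrite scaler0 addr0.
- by move=> f g; rewrite !mulr0 addr0.
- move=> a f g.
  change (h * X (a *: f + g) + Y (a *: f + g) =
          a *: (h * X f + Y f) + (h * X g + Y g)).
  by rewrite Xl Yl mulrDr scalerDr scalerAr addrACA.
- move=> f g.
  change (h * X (f * g) + Y (f * g) =
          f * (h * X g + Y g) + g * (h * X f + Y f)).
  by rewrite XM YM !mulrDr addrACA !(mulrCA h).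
Qed.

HB.instance Definition _ := GRing.SubChoice_isSubLmodule.Build
  C (C -> C^o) derivation_pred vfield derivation_submod_closed.

Lemma lie_subproof (X Y : vfield) :
  (fun f => X (Y f) - Y (X f)) \in derivation_pred.
Proof.
have /asboolP[Xl XM] := vfieldP X; have /asboolP[Yl YM] := vfieldP Y.
have D1 Z f g : derivation Z -> Z (f + g) = Z f + Z g.
  by case=> Zl _; rewrite -[f]scale1r Zl !scale1r.
have XD f g := D1 X f g (conj Xl XM); have YD f g := D1 Y f g (conj Yl YM).
apply/asboolP; split=> [a f g|f g].
  by rewrite Xl Yl Xl Yl scalerBr opprD addrACA.
change (X (Y (f * g)) - Y (X (f * g)) =
        f * (X (Y g) - Y (X g)) + g * (X (Y f) - Y (X f)) :> C).
rewrite XM YM XD YD !XM !YM !mulrBr.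
by ring.
Qed.

Definition lie (X Y : vfield) : vfield := VField (lie_subproof X Y).

End VectorFields.

(* A tensor field is a map between modules of sections that is multilinear over
   the ring of smooth functions: {scalar vfield M} is the type of 1-forms and
   {linear vfield M -> vfield M} that of (1,1)-tensor fields. *)
Section Tensors.
Variables (R : realType) (d : nat) (M : manifold R d).
Local Notation C := (smoothfun M).
Local Notation V := (vfield M).
Implicit Types (X Y Z : V) (x : M).

(* The tangent vector of X at x, as a derivation at x, is not zero. *)
Definition nonzero_at X x := exists f : C, X f x != 0.

Definition riemannian_metric (g : V -> V -> C) : Prop :=
  [/\ forall X, scalar (g X),
      forall X Y, g X Y = g Y X &
      forall X x, nonzero_at X x -> 0 < g X X x].

Definition levi_civita (g : V -> V -> C) (nabla : V -> V -> V) : Prop :=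
  [/\ forall Y, linear (nabla^~ Y),
      forall X Y Z, nabla X (Y + Z) = nabla X Y + nabla X Z,
      forall X (f : C) Y, nabla X (f *: Y) = (X f : C) *: Y + f *: nabla X Y,
      forall X Y, nabla X Y - nabla Y X = lie X Y &
      forall X Y Z, X (g Y Z) = g (nabla X Y) Z + g Y (nabla X Z)].

Definition curvature (nabla : V -> V -> V) X Y Z : V :=
  nabla X (nabla Y Z) - nabla Y (nabla X Z) - nabla (lie X Y) Z.

Definition dform1 (eta : V -> C) X Y : C :=
  X (eta Y) - Y (eta X) - eta (lie X Y).

Definition dform2 (w : V -> V -> C) X Y Z : C :=
  X (w Y Z) + Y (w Z X) + Z (w X Y)
  - w (lie X Y) Z - w (lie Y Z) X - w (lie Z X) Y.

Definition nijenhuis (phi : V -> V) X Y : V :=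
  phi (phi (lie X Y)) + lie (phi X) (phi Y)
  - phi (lie (phi X) Y) - phi (lie X (phi Y)).

(* k-forms, and the wedge product normalised in accordance with dform1:
   (a /\ b)(X, Y) = a(X) b(Y) - a(Y) b(X) for 1-forms a and b. *)
Definition form k := ('I_k -> V) -> C.

Definition wedge k l (a : form k) (b : form l) : form (k + l) := fun v =>
  ((k`! * l`!)%:R^-1 : R) *: \sum_(s : 'S_(k + l))
    (-1) ^+ s * (a (fun i => v (s (lshift l i))) *
                 b (fun j => v (s (rshift k j)))).

Fixpoint wedge_exp (w : form 2) (p : nat) : form (p * 2) :=
  if p is q.+1 then wedge w (@wedge_exp w q) else fun=> 1.
Arguments wedge_exp w p _ : clear implicits.

Definition form1 (eta : V -> C) : form 1 := fun v => eta (v ord0).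
Definition form2 (w : V -> V -> C) : form 2 := fun v => w (v ord0) (v ord_max).

(* eta /\ (d eta)^p vanishes at no point, while (d eta)^(p+1) is identically 0. *)
Definition has_rank (eta : V -> C) (r : nat) : Prop := exists p : nat,
  [/\ r = (2 * p + 1)%N,
      forall x, exists v,
        wedge (form1 eta) (wedge_exp (form2 (dform1 eta)) p) v x != 0 &
      forall v, wedge_exp (form2 (dform1 eta)) p.+1 v = 0].

End Tensors.

Arguments wedge_exp {R d M} w p _.

Section QuasiSasakian.
Variables (R : realType) (d : nat) (M : manifold R d).
Local Notation C := (smoothfun M).
Local Notation V := (vfield M).
Variable g : V -> V -> C.
Implicit Types (X Y : V).

Definition almost_contact_metric (phi : {linear V -> V}) (xi : V)
    (eta : {scalar V}) : Prop :=
  [/\ riemannian_metric g,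
      forall X, phi (phi X) = - X + eta X *: xi,
      eta xi = 1 &
      forall X Y, g (phi X) (phi Y) = g X Y - eta X * eta Y].

Definition normal (phi : {linear V -> V}) (xi : V) (eta : {scalar V}) : Prop :=
  forall X Y, nijenhuis phi X Y + dform1 eta X Y *: xi = 0.

Definition fundamental_form (phi : {linear V -> V}) X Y : C := g X (phi Y).

Definition quasi_sasakian (phi : {linear V -> V}) (xi : V)
    (eta : {scalar V}) : Prop :=
  [/\ almost_contact_metric phi xi eta,
      normal phi xi eta &
      forall X Y Z, dform2 (fundamental_form phi) X Y Z = 0].

(* The index set {1, 2, 3} is rendered as 'I_3, with elements 0, 1, 2. *)
Variables (phi : 'I_3 -> {linear V -> V}) (xi : 'I_3 -> V)
  (eta : 'I_3 -> {scalar V}).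

Definition three_quasi_sasakian : Prop :=
  (forall a, quasi_sasakian (phi a) (xi a) (eta a)) /\
  forall s : 'S_3, ~~ odd_perm s ->
    let a := s 0 in let b := s 1 in let c := s 2 in
    [/\ forall X, phi c X = phi a (phi b X) - eta b X *: xi a,
        forall X, phi c X = - phi b (phi a X) + eta a X *: xi b,
        xi c = phi a (xi b) /\ xi c = - phi b (xi a),
        forall X, eta c X = eta a (phi b X) &
        forall X, eta c X = - eta b (phi a X)].

Definition three_qs_rank (r : nat) : Prop := forall a, has_rank (eta a) r.

Definition horizontal X : Prop := forall a, eta a X = 0.

(* E4m and E4l3 hold of the sections of the distribution E^{4m} and of its
   orthogonal complement E^{4l+3}; the ranks 4m and 4l+3 play no role in the
   definitions. *)
Definition E4m X : Prop :=
  horizontal X /\ forall a Y, dform1 (eta a) X Y = 0.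

Definition E4l3 X : Prop := forall Y, E4m Y -> g X Y = 0.

Definition is_psi (psi : 'I_3 -> {linear V -> V}) : Prop := forall a,
  (forall X, E4l3 X -> psi a X = phi a X) /\
  (forall X, E4m X -> psi a X = 0).

End QuasiSasakian.

(* Main.v *)
Require Import Defs.
From HB Require Import structures.
From mathcomp Require Import all_boot all_order all_algebra all_fingroup.
From mathcomp Require Import ring.
From mathcomp Require Import all_classical all_reals all_analysis.

Set Implicit Arguments.
Unset Strict Implicit.
Unset Printing Implicit Defensive.

Import Order.TTheory GRing.Theory Num.Theory numFieldNormedType.Exports.

Local Open Scope classical_set_scope.
Local Open Scope ring_scope.

(* For a quasi-Sasakian structure, normality and d Phi = 0 give that nabla xi is
   skew and commutes with phi, and (nabla_X phi) Y = g(A X, Y) xi - eta(Y) A X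
   with A = phi o nabla xi. Differentiating phi_3 = phi_1 phi_2 - eta_2 xi_1
   shows that the three tensors phi_a o nabla xi_a differ only on the Reeb
   directions, and that A = phi_a o nabla xi_a + (c/2) eta_a xi_a is the same
   for a = 1, 2, 3. It is self-adjoint, commutes with each phi_a, and satisfies
   A xi_a = (c/2) xi_a and nabla xi_a = - phi_a A.

   Put B = A^2 - (c/2) A. Then (nabla_X A) xi_a = phi_a B X, and d(d eta_a) = 0
   reads: the cyclic sum of g(phi_a (nabla_X A) Y, Z) + eta_a(Z) g(B X, Y) is 0.
   Evaluating on Z = xi_a gives nabla_{xi_a} A = 0, and then on Z = xi_b gives
   B = 0, so that A is c/2 times a projection (onto E^{4l+3} if c <> 0). For
   T(X, Y) = (nabla_X A) Y - (nabla_Y A) X the cyclic identities now yield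
   T(X, phi_a Y) = phi_a T(X, Y) for all a; as T is alternating and phi_1, phi_2
   anticommute on its values, T = 0. Hence R_XY xi_a =
   (c/2) (eta_a(Y) A X - eta_a(X) A Y), and psi_a = (2/c) phi_a A if c <> 0. *)

(** * Vector fields as derivations, up to d(d eta) = 0 *)

Section VectorFieldCalculus.
Variables (R : realType) (d : nat) (M : manifold R d).
Local Notation C := (smoothfun M).
Local Notation V := (vfield M).
Implicit Types (f h : C) (X Y Z : V).

Lemma vfield_eqP X Y : (forall f, X f = Y f) -> X = Y.
Proof. by move=> XY; apply/val_inj/funext. Qed.

(** Halving is available because smooth functions form an algebra over [R]; identities that come out
    doubled are divided by 2 through this lemma. *)
Lemma smoothfun_addrr_eq0 f : f + f = 0 -> f = 0.
Proof.
move=> ff; suff -> : f = (2^-1 : R) *: (f + f) by rewrite ff scaler0.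
rewrite -[f in f + f](scale1r (R := R)) -scalerDl scalerA.
by rewrite mulVf ?scale1r ?pnatr_eq0.
Qed.

Lemma vfieldD X f h : X (f + h) = (X f + X h : C).
Proof.
by have /asboolP[Xl _] := vfieldP X; rewrite -[f in LHS]scale1r Xl scale1r.
Qed.

Lemma vfieldM X f h : X (f * h) = (f * (X h : C) + h * (X f : C) : C).
Proof. by have /asboolP[_ ->] := vfieldP X. Qed.

Lemma vfield0 X : X 0 = (0 : C).
Proof. by apply: (addrI (X 0 : C)); rewrite -vfieldD !addr0. Qed.

Lemma vfieldN X f : X (- f) = (- (X f : C) : C).
Proof. by apply: (addrI (X f : C)); rewrite -vfieldD !subrr vfield0. Qed.

Lemma vfieldB X f h : X (f - h) = ((X f : C) - (X h : C) : C).
Proof. by rewrite vfieldD vfieldN. Qed.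

Lemma vfield_cst X (a : R) : X a%:A = (0 : C).
Proof.
have /asboolP[Xl _] := vfieldP X.
have X1 : X 1 = (0 : C).
  apply: (addrI (X 1 : C)); rewrite addr0.
  by have := vfieldM X 1 1; rewrite mulr1 mul1r => /esym.
by have := Xl a 1 0; rewrite addr0 X1 vfield0 scaler0 addr0.
Qed.

Lemma lieE X Y f : lie X Y f = ((X (Y f) : C) - (Y (X f) : C) : C).
Proof. by []. Qed.

Lemma vfieldDE X Y f : (X + Y) f = ((X f : C) + (Y f : C) : C).
Proof. by []. Qed.

Lemma lieC X Y : lie Y X = - lie X Y.
Proof. by apply: vfield_eqP => f; apply/esym/(opprB (X (Y f) : C)). Qed.

Lemma lie_jacobi X Y Z :
  lie (lie X Y) Z + lie (lie Y Z) X + lie (lie Z X) Y = 0.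
Proof.
apply: vfield_eqP => f; rewrite !vfieldDE !lieE !vfieldB.
by transitivity (0 : C); first ring.
Qed.

(** All derivatives of values of [eta] cancel; what remains is [eta] of the Jacobi sum. *)
Lemma dform2_dform1 (eta : {scalar V}) X Y Z : dform2 (dform1 eta) X Y Z = 0.
Proof.
have: eta (lie (lie X Y) Z + lie (lie Y Z) X + lie (lie Z X) Y) = (0 : C).
  by rewrite lie_jacobi raddf0.
rewrite !raddfD /= /dform2 /dform1 !vfieldB !lieE => <-.
ring.
Qed.

End VectorFieldCalculus.

(* Locked so that the module rewriting rules do not unfold it up to
   conversion. *)
HB.lock Definition cov (R : realType) (d : nat) (M : manifold R d)
    (nabla : vfield M -> vfield M -> vfield M) (T : vfield M -> vfield M)
    (X Y : vfield M) : vfield M :=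
  nabla X (T Y) - T (nabla X Y).

Lemma covE (R : realType) (d : nat) (M : manifold R d)
    (nabla : vfield M -> vfield M -> vfield M) T X Y :
  cov nabla T X Y = nabla X (T Y) - T (nabla X Y).
Proof. by rewrite cov.unlock. Qed.

(** * The metric and its Levi-Civita connection *)

Section Metric.
Variables (R : realType) (d : nat) (M : manifold R d).
Local Notation C := (smoothfun M).
Local Notation V := (vfield M).
Variable g : V -> V -> C.
Hypothesis gP : riemannian_metric g.
Implicit Types (f h : C) (X Y Z : V).

Lemma metricC X Y : g X Y = g Y X.
Proof. by case: gP. Qed.

Lemma metricDr X Y Z : g X (Y + Z) = g X Y + g X Z.
Proof. by case: gP => gl _ _; have := gl X 1 Y Z; rewrite scale1r mul1r. Qed.

Lemma metric0r X : g X 0 = 0.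
Proof. by apply: (addrI (g X 0)); rewrite -metricDr !addr0. Qed.

Lemma metricZr f X Y : g X (f *: Y) = f * g X Y.
Proof.
by case: gP => gl _ _; have := gl X f Y 0; rewrite metric0r !addr0.
Qed.

Lemma metricNr X Y : g X (- Y) = - g X Y.
Proof. by rewrite -scaleN1r metricZr mulN1r. Qed.

Lemma metricDl X Y Z : g (X + Y) Z = g X Z + g Y Z.
Proof. by rewrite metricC metricDr !(metricC Z). Qed.

Lemma metricZl f X Y : g (f *: X) Y = f * g X Y.
Proof. by rewrite metricC metricZr metricC. Qed.

Lemma metricNl X Y : g (- X) Y = - g X Y.
Proof. by rewrite metricC metricNr metricC. Qed.

Lemma metric0l X : g 0 X = 0.
Proof. by rewrite metricC metric0r. Qed.

Definition metricE := (metricDl, metricDr, metricZl, metricZr, metricNl,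
  metricNr, metric0l, metric0r).

Lemma metric_eq0 X : g X X = 0 -> X = 0.
Proof.
case: gP => _ _ pos gX; apply: vfield_eqP => f; apply/val_inj/funext => x.
apply/eqP/negPn/negP => Xf; have := pos X x (ex_intro _ f Xf).
by rewrite gX ltxx.
Qed.

(** Pairing with an arbitrary vector field reduces identities between vector fields to identities
    between functions, which [ring] can settle. *)
Lemma metric_inj X Y : (forall Z, g X Z = g Y Z) -> X = Y.
Proof.
move=> XY; apply/eqP; rewrite -subr_eq0; apply/eqP/metric_eq0.
by rewrite metricDl metricNl XY subrr.
Qed.

(** Nondegeneracy makes every self-adjoint map linear; this serves [shape], which is a bare function
    and not a bundled linear map. *)
Lemma self_adjointD T X Y : (forall Y Z, g (T Y) Z = g Y (T Z)) ->
  T (X + Y) = T X + T Y.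
Proof. by move=> Ts; apply: metric_inj => Z; rewrite Ts !metricDl !Ts. Qed.

Lemma self_adjointZ T f X : (forall Y Z, g (T Y) Z = g Y (T Z)) ->
  T (f *: X) = f *: T X.
Proof. by move=> Ts; apply: metric_inj => Z; rewrite Ts !metricZl !Ts. Qed.

Variable nabla : V -> V -> V.
Hypothesis nablaP : levi_civita g nabla.
Local Notation cov := (cov nabla).

Lemma nablaDl X Y Z : nabla (X + Y) Z = nabla X Z + nabla Y Z.
Proof.
by case: nablaP => nl _ _ _ _; have := nl Z 1 X Y; rewrite !scale1r.
Qed.

Lemma nabla0l Z : nabla 0 Z = 0.
Proof. by apply: (addrI (nabla 0 Z)); rewrite -nablaDl !addr0. Qed.

Lemma nablaZl f X Y : nabla (f *: X) Y = f *: nabla X Y.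
Proof.
by case: nablaP => nl _ _ _ _; have := nl Y f X 0; rewrite nabla0l !addr0.
Qed.

Lemma nablaNl X Y : nabla (- X) Y = - nabla X Y.
Proof. by rewrite -scaleN1r nablaZl scaleN1r. Qed.

Lemma nablaDr X Y Z : nabla X (Y + Z) = nabla X Y + nabla X Z.
Proof. by case: nablaP. Qed.

Lemma nablaZr X f Y : nabla X (f *: Y) = (X f : C) *: Y + f *: nabla X Y.
Proof. by case: nablaP. Qed.

Lemma nabla0r X : nabla X 0 = 0.
Proof. by apply: (addrI (nabla X 0)); rewrite -nablaDr !addr0. Qed.

Lemma nablaNr X Y : nabla X (- Y) = - nabla X Y.
Proof. by apply: (addrI (nabla X Y)); rewrite -nablaDr !subrr nabla0r. Qed.

Lemma nablaB X Y : lie X Y = nabla X Y - nabla Y X.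
Proof. by case: nablaP. Qed.

Lemma nabla_metric X Y Z :
  X (g Y Z) = (g (nabla X Y) Z + g Y (nabla X Z) : C).
Proof. by case: nablaP. Qed.

Lemma cov_self_adjoint T X Y Z : (forall Y Z, g (T Y) Z = g Y (T Z)) ->
  g (cov T X Y) Z = g Y (cov T X Z).
Proof.
move=> Ts; have := congr1 (fun f => X f : C) (Ts Y Z).
rewrite !covE !nabla_metric !metricE !Ts => /(canRL (addrK _)) ->; ring.
Qed.

Lemma cov_skew_adjoint T X Y Z : (forall Y Z, g (T Y) Z = - g Y (T Z)) ->
  g (cov T X Y) Z = - g Y (cov T X Z).
Proof.
move=> Ts; have := congr1 (fun f => X f : C) (Ts Y Z).
rewrite !covE vfieldN !nabla_metric !metricE !Ts => /(canRL (addrK _)) ->; ring.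
Qed.

(** As nabla has no torsion, the exterior derivative of a 2-form is the cyclic sum of its covariant
    derivative. *)
Lemma dform2_cov T X Y Z : (forall Y Z, g (T Y) Z = - g Y (T Z)) ->
  dform2 (fun X Y => g X (T Y)) X Y Z =
  g (cov T X Z) Y + g (cov T Y X) Z + g (cov T Z Y) X.
Proof.
move=> Ts; rewrite /dform2 !covE !nabla_metric !nablaB !metricE !Ts.
rewrite (metricC _ Y) (metricC _ Z) (metricC _ X); ring.
Qed.

End Metric.

(** * Algebra of one almost contact metric structure *)

Section AlmostContactMetric.
Variables (R : realType) (d : nat) (M : manifold R d).
Local Notation C := (smoothfun M).
Local Notation V := (vfield M).
Variables (g : V -> V -> C) (phi : {linear V -> V}) (xi : V).
Variable eta : {scalar V}.
Hypothesis acm : almost_contact_metric g phi xi eta.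
Implicit Types (f h : C) (X Y Z : V).

Lemma acm_metric : riemannian_metric g. Proof. by case: acm. Qed.
Local Notation gP := acm_metric.
Local Notation gE := (metricE gP).

Lemma phiK X : phi (phi X) = - X + eta X *: xi.
Proof. by case: acm. Qed.

Lemma eta_xi : eta xi = 1.
Proof. by case: acm. Qed.

Lemma metric_phi X Y : g (phi X) (phi Y) = g X Y - eta X * eta Y.
Proof. by case: acm. Qed.

Lemma phi_xi : phi xi = 0.
Proof.
have p2 : phi (phi xi) = 0 by rewrite phiK eta_xi scale1r addNr.
have := phiK (phi xi); rewrite p2 linear0 => /esym/eqP.
rewrite addrC subr_eq0 => /eqP; set t := eta (phi xi) => tE.
have t0 : t * t = 0.
  have := congr1 eta (congr1 (fun X => phi X) tE).
  rewrite p2 linearZ /= -tE scalerA linearZ /= eta_xi raddf0.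
  by move/eqP; rewrite mulr1 => /eqP.
(* Here g(phi xi, phi xi) = t^2 g(xi, xi), so positivity of the metric replaces the deduction of t =
   0 from t^2 = 0. *)
by apply: (metric_eq0 gP); rewrite -tE !gE mulrA t0 mul0r.
Qed.

(** Computing phi^3 X from the inside gives - phi X, and from the outside - phi X + eta(phi X)
    xi. *)
Lemma eta_phi X : eta (phi X) = 0.
Proof.
have: phi (phi (phi X)) = - phi X.
  by rewrite (phiK X) linearD linearN linearZ /= phi_xi scaler0 addr0.
rewrite phiK => /(canRL (addKr _)); rewrite opprK addrN => /(congr1 eta).
by rewrite linearZ /= eta_xi raddf0; move/eqP; rewrite mulr1 => /eqP.
Qed.

Lemma eta_metric X : eta X = g X xi.
Proof.
have := metric_phi X xi; rewrite phi_xi eta_xi mulr1 (metric0r gP).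
by move/esym/eqP; rewrite subr_eq0 => /eqP.
Qed.

Lemma phi_skew X Y : g (phi X) Y = - g X (phi Y).
Proof.
have := metric_phi (phi X) Y; rewrite eta_phi mul0r subr0 => <-.
by rewrite phiK !gE (metricC gP xi) -eta_metric eta_phi mulr0 addr0.
Qed.

End AlmostContactMetric.

(** * Covariant derivatives in one quasi-Sasakian structure *)

Section QuasiSasakian.
Variables (R : realType) (d : nat) (M : manifold R d).
Local Notation C := (smoothfun M).
Local Notation V := (vfield M).
Variables (g : V -> V -> C) (nabla : V -> V -> V).
Variables (phi : {linear V -> V}) (xi : V) (eta : {scalar V}).
Hypothesis nablaP : levi_civita g nabla.
Hypothesis qs : quasi_sasakian g phi xi eta.
Implicit Types (f h : C) (X Y Z : V).

Lemma qs_acm : almost_contact_metric g phi xi eta. Proof. by case: qs. Qed.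
Local Notation gP := (acm_metric qs_acm).
Local Notation gE := (metricE gP).
Local Notation S X := (nabla X xi).
Local Notation covphi := (cov nabla phi).

Lemma nabla_xi_xi X : g (S X) xi = 0.
Proof.
apply: smoothfun_addrr_eq0; rewrite -[in X in _ + X](metricC gP).
rewrite -(nabla_metric nablaP) -(eta_metric qs_acm) (eta_xi qs_acm).
by rewrite -[1]scale1r vfield_cst.
Qed.

Lemma dform1_nabla X Y : dform1 eta X Y = g (S X) Y - g (S Y) X.
Proof.
rewrite /dform1 !(eta_metric qs_acm) !(nabla_metric nablaP) (nablaB nablaP) !gE.
rewrite (metricC gP Y (S X)) (metricC gP X (S Y)); ring.
Qed.

Lemma cov_phi_skew X Y Z : g (covphi X Y) Z = - g Y (covphi X Z).
Proof. exact: (cov_skew_adjoint gP nablaP _ _ _ (phi_skew qs_acm)). Qed.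

Lemma cov_phi_xi X : covphi X xi = - phi (S X).
Proof. by rewrite !covE (phi_xi qs_acm) (nabla0r nablaP) sub0r. Qed.

Lemma cov_phi0 Y : covphi 0 Y = 0.
Proof. by rewrite !covE !(nabla0l nablaP) linear0 subr0. Qed.

(** Normality with each bracket expanded as a difference of covariant derivatives. *)
Lemma normal_cov X Y : covphi (phi X) Y - covphi (phi Y) X
  - phi (covphi X Y) + phi (covphi Y X) + dform1 eta X Y *: xi = 0.
Proof.
case: qs => _ nrm _; rewrite -(nrm X Y); congr (_ + _).
rewrite !covE /nijenhuis !(nablaB nablaP) !linearB /=.
apply: (metric_inj gP) => Z; rewrite !gE; ring.
Qed.

Lemma cov_phi_cyclic X Y Z :
  g (covphi X Z) Y + g (covphi Y X) Z + g (covphi Z Y) X = 0.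
Proof.
case: qs => _ _ closed; have := closed X Y Z.
by rewrite (dform2_cov gP nablaP X Y Z (phi_skew qs_acm)).
Qed.

(** In the [eta] component of normality at [(X, xi)] every other term vanishes or lies in the image
    of [phi]. *)
Lemma dform1_eta_xi X : dform1 eta X xi = 0.
Proof.
have := congr1 eta (normal_cov X xi).
rewrite (phi_xi qs_acm) cov_phi0 !cov_phi_xi.
rewrite !(raddfD, raddfN, raddf0, opprK) /= linearZ /=.
rewrite !(eta_phi qs_acm) (eta_xi qs_acm).
by rewrite mulr1 !(oppr0, add0r, addr0).
Qed.

Lemma nabla_xi_self : S xi = 0.
Proof.
apply: (metric_inj gP) => Z; rewrite (metric0l gP).
have := dform1_eta_xi Z; rewrite dform1_nabla nabla_xi_xi sub0r.
by move/eqP; rewrite oppr_eq0 => /eqP.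
Qed.

Lemma nabla_phi_phi X : S (phi (phi X)) = - S X.
Proof.
rewrite (phiK qs_acm) (nablaDl nablaP) (nablaNl nablaP) (nablaZl nablaP).
by rewrite nabla_xi_self scaler0 addr0.
Qed.

Lemma metric_cov_phi_xi X Y :
  g (covphi xi Y) X = g (phi (S X)) Y - g X (phi (S Y)).
Proof.
have := cov_phi_cyclic xi X Y.
rewrite (cov_phi_skew Y X xi) !cov_phi_xi !gE opprK => /eqP.
by rewrite -addrA addr_eq0 => /eqP ->; ring.
Qed.

Lemma nabla_xi_skew X Y : g (S X) Y = - g X (S Y).
Proof.
(* Skewness on the image of [phi] comes from normality at [(U, xi)], with nabla_xi phi eliminated by
   d Phi = 0. *)
have Sphi U W : g (S (phi U)) (phi W) = - g (S (phi W)) (phi U).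
  have := congr1 (fun X => g X W) (normal_cov U xi).
  rewrite dform1_eta_xi scale0r addr0 (phi_xi qs_acm) !cov_phi_xi.
  rewrite cov_phi0 subr0 !linearN /= opprK !gE.
  rewrite !(phi_skew qs_acm _ W) metric_cov_phi_xi.
  rewrite (metricC gP (phi W)).
  move=> E; apply/eqP; rewrite -addr_eq0 -E; apply/eqP.
  rewrite (phi_skew qs_acm _ U); ring.
(* Since phi^2 = - id up to the [xi] direction, and [S xi] and g(S X, xi) vanish, skewness extends
   to all vector fields. *)
have : g (S X) (phi (phi Y)) = - g (S Y) (phi (phi X)).
  have := Sphi (phi X) (phi Y); rewrite !nabla_phi_phi !gE.
  by move/oppr_inj.
rewrite !(phiK qs_acm) !gE !nabla_xi_xi !mulr0 !addr0 opprK.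
by rewrite (metricC gP (S Y)) => <-; rewrite opprK.
Qed.

Lemma dform1_qs X Y : dform1 eta X Y = g (S X) Y + g (S X) Y.
Proof. by rewrite dform1_nabla (nabla_xi_skew Y) (metricC gP Y) opprK. Qed.

(** The [eta] component of normality is eta([phi X, phi Y]) + d eta(X, Y) = 0, and the bracket term
    is - d eta(phi X, phi Y) because eta o phi = 0. *)
Lemma dform1_phi X Y : dform1 eta (phi X) (phi Y) = dform1 eta X Y.
Proof.
case: qs => _ nrm _; have := congr1 eta (nrm X Y).
rewrite /nijenhuis !(raddfD, raddfN, raddf0) /= linearZ /= !(eta_phi qs_acm).
rewrite (eta_xi qs_acm) mulr1 !oppr0 !addr0 add0r => /eqP.
rewrite addrC addr_eq0 => /eqP ->.
by rewrite /dform1 !(eta_phi qs_acm) !vfield0 subrr sub0r.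
Qed.

(** Invariance of d eta under phi gives phi S phi = - S; applying phi once more yields the
    commutation, as S takes values orthogonal to [xi]. *)
Lemma nabla_xi_phi X : S (phi X) = phi (S X).
Proof.
have SphiE U : phi (S (phi U)) = - S U.
  apply: (metric_inj gP) => Z; rewrite (phi_skew qs_acm) !gE; congr (- _).
  have /eqP := dform1_phi U Z; rewrite -subr_eq0 !dform1_qs => /eqP E.
  apply/eqP; rewrite -subr_eq0; apply/eqP/smoothfun_addrr_eq0.
  by rewrite -[RHS]E; ring.
have eS U : eta (S U) = 0 by rewrite (eta_metric qs_acm) nabla_xi_xi.
have := congr1 phi (SphiE X); rewrite (phiK qs_acm) eS scale0r addr0 linearN.
exact: oppr_inj.
Qed.

Lemma cov_phi X Y :
  covphi X Y = g (phi (S X)) Y *: xi - eta Y *: phi (S X).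
Proof.
(* Normality at [(U, W)] paired with [Z]; the two terms with an outer [phi] are merged by d Phi = 0
   at [(U, phi Z, W)]. *)
have nrm U W Z : g (covphi (phi U) W) Z + g (covphi (phi W) Z) U
    - g (covphi (phi Z) U) W = - (dform1 eta U W * eta Z).
  have := congr1 (fun X => g X Z) (normal_cov U W).
  rewrite !gE (metricC gP xi) -(eta_metric qs_acm) => /eqP.
  rewrite addr_eq0 => /eqP <-; rewrite !(phi_skew qs_acm (covphi _ _)).
  have := cov_phi_cyclic U (phi Z) W.
  rewrite (cov_phi_skew W (phi Z) U) (cov_phi_skew (phi W) U Z).
  rewrite (metricC gP U) (metricC gP (phi Z)) => /eqP.
  by rewrite -addrA addr_eq0 => /eqP ->; ring.
(* Adding [nrm] at [(U, W, Z)] and at [(Z, U, W)] leaves twice the first term. *)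
have covphiphi U W Z : g (covphi (phi U) W) Z
    = g (S U) Z * eta W - g (S U) W * eta Z.
  apply/eqP; rewrite -subr_eq0; apply/eqP/smoothfun_addrr_eq0.
  have SZU : g (S Z) U = - g (S U) Z by rewrite nabla_xi_skew (metricC gP).
  have E1 := nrm U W Z; have E2 := nrm Z U W.
  rewrite !dform1_qs SZU in E1 E2.
  transitivity (- ((g (S U) W + g (S U) W) * eta Z)
    - ((- g (S U) Z - g (S U) Z) * eta W)
    - (g (S U) Z * eta W - g (S U) W * eta Z) *+ 2); last by ring.
  by rewrite -E1 -E2; ring.
have covxi U : covphi xi U = 0.
  apply: (metric_inj gP) => Z; rewrite metric_cov_phi_xi (metric0l gP).
  rewrite -[g Z _]opprK -(phi_skew qs_acm) -nabla_xi_phi.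
  by rewrite nabla_xi_skew subrr.
(* As [covphi xi] vanishes, [X] may be replaced by - phi(phi X), to which [covphiphi] applies. *)
have -> : covphi X Y = - covphi (phi (phi X)) Y.
  rewrite (phiK qs_acm) !covE !(nablaDl nablaP, nablaNl nablaP, nablaZl nablaP).
  rewrite [phi (_ + _)]linearD [phi (- _)]linearN [phi (_ *: _)]linearZ /=.
  have := covxi Y; rewrite covE => /eqP; rewrite subr_eq0 => /eqP ->.
  by apply: (metric_inj gP) => Z; rewrite !gE; ring.
apply: (metric_inj gP) => Z; rewrite !gE covphiphi nabla_xi_phi.
by rewrite (metricC gP xi) -(eta_metric qs_acm); ring.
Qed.

Lemma metric_phi_nabla_xi X Y : g (phi (S X)) Y = g X (phi (S Y)).
Proof.
by rewrite (phi_skew qs_acm) -nabla_xi_phi nabla_xi_skew opprK nabla_xi_phi.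
Qed.

(** This is d(d eta) = 0, since d eta is twice the 2-form g(nabla_X xi, Y). *)
Lemma cov_nabla_xi_cyclic X Y Z :
  g (cov nabla (nabla^~ xi) X Y) Z + g (cov nabla (nabla^~ xi) Y Z) X
    + g (cov nabla (nabla^~ xi) Z X) Y = 0.
Proof.
apply: smoothfun_addrr_eq0.
have dE U W : dform1 eta U W = - (g U (S W) + g U (S W)).
  by rewrite dform1_qs nabla_xi_skew opprD.
have := dform2_dform1 eta X Z Y; rewrite /dform2 !dE !(vfieldN, vfieldD).
have := dform2_cov gP nablaP X Z Y nabla_xi_skew; rewrite /dform2.
set u := g (cov _ _ X Y) Z; move=> E1 E2.
rewrite [u + _ + _]addrAC.
rewrite -E1 -[RHS]oppr0 -{}E2; ring.
Qed.

End QuasiSasakian.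

(** Translation by [a] in Z/3 has trivial cube, hence is even. The structure relations can thus be
    indexed by [a], [a + 1], [a + 2]. *)
Lemma even_perm_cyclic (a : 'I_3) :
  exists s : 'S_3, [/\ ~~ odd_perm s, s 0 = a, s 1 = a + 1 & s 2 = a + 2].
Proof.
pose s := perm (addIr a); exists s; split; rewrite ?permE ?add0r 1?addrC//.
have s3 : (s * (s * s))%g = 1%g.
  apply/permP => i; rewrite !permM !permE -!addrA.
  suff -> : a + (a + a) = 0 by rewrite addr0.
  by case: a {s} => -[|[|[|//]]] lta; apply/val_inj.
have := congr1 (@odd_perm _) s3; rewrite !odd_permM odd_perm1.
by case: odd_perm.
Qed.

(* For k = c/2 this is the tensor A of the header; the index 0 is immaterial
   by shapeE. *)
HB.lock Definition shape (R : realType) (d : nat) (M : manifold R d)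
    (nabla : vfield M -> vfield M -> vfield M)
    (phi : 'I_3 -> {linear vfield M -> vfield M}) (xi : 'I_3 -> vfield M)
    (eta : 'I_3 -> {scalar vfield M}) (k : smoothfun M) (X : vfield M) :=
  phi 0 (nabla X (xi 0)) + (k * eta 0 X) *: xi 0.

(** For A = [shape] and k = c/2 this is the tensor B of the header. *)
HB.lock Definition defect (R : realType) (d : nat) (M : manifold R d)
    (k : smoothfun M) (A : vfield M -> vfield M) (X : vfield M) :=
  A (A X) - k *: A X.

(** * Quaternionic relations between the three structures *)

Section ThreeStructure.
Variables (R : realType) (d : nat) (M : manifold R d).
Local Notation C := (smoothfun M).
Local Notation V := (vfield M).
Variables (g : V -> V -> C) (phi : 'I_3 -> {linear V -> V}).
Variables (xi : 'I_3 -> V) (eta : 'I_3 -> {scalar V}).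
Hypothesis tqs : three_quasi_sasakian g phi xi eta.
Implicit Types (f h : C) (X Y Z : V) (a : 'I_3).

Lemma tqs_qs a : quasi_sasakian g (phi a) (xi a) (eta a).
Proof. by case: tqs. Qed.

Lemma tqs_acm a : almost_contact_metric g (phi a) (xi a) (eta a).
Proof. exact: qs_acm (tqs_qs a). Qed.

Lemma tqs_metric : riemannian_metric g.
Proof. exact: acm_metric (tqs_acm 0). Qed.

Lemma ord3_add (a : 'I_3) : (a + 1 + 1 = a + 2) * (a + 1 + 2 = a)
  * (a + 2 + 1 = a) * (a + 2 + 2 = a + 1).
Proof.
by do !split; case: a => -[|[|[|//]]] lta; apply/val_inj.
Qed.

Lemma phi_phi a X :
  phi a (phi (a + 1) X) = phi (a + 2) X + eta (a + 1) X *: xi a.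
Proof.
case: tqs => _ /(_ _); have [s [s_even <- <- <-]] := even_perm_cyclic a.
by move=> /(_ s s_even)[-> _ _ _ _]; rewrite subrK.
Qed.

Lemma phi_phi_rev a X :
  phi (a + 1) (phi a X) = - phi (a + 2) X + eta a X *: xi (a + 1).
Proof.
case: tqs => _ /(_ _); have [s [s_even <- <- <-]] := even_perm_cyclic a.
by move=> /(_ s s_even)[_ -> _ _ _]; rewrite opprD opprK subrK.
Qed.

Lemma phi_xi_succ a : phi a (xi (a + 1)) = xi (a + 2).
Proof.
case: tqs => _ /(_ _); have [s [s_even <- <- <-]] := even_perm_cyclic a.
by move=> /(_ s s_even)[_ _ [-> _] _ _].
Qed.

Lemma phi_xi_pred a : phi (a + 1) (xi a) = - xi (a + 2).
Proof.
case: tqs => _ /(_ _); have [s [s_even <- <- <-]] := even_perm_cyclic a.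
by move=> /(_ s s_even)[_ _ [_ ->] _ _]; rewrite opprK.
Qed.

Lemma eta_xi_succ a : eta a (xi (a + 1)) = 0.
Proof.
have -> : xi (a + 1) = - phi a (xi (a + 2)).
  by have := phi_xi_pred (a + 2); rewrite !ord3_add => ->; rewrite opprK.
by rewrite raddfN /= (eta_phi (tqs_acm _)) oppr0.
Qed.

Lemma eta_xi_pred a : eta (a + 1) (xi a) = 0.
Proof.
rewrite (eta_metric (tqs_acm _)) (metricC tqs_metric).
by rewrite -(eta_metric (tqs_acm _)) eta_xi_succ.
Qed.

(** * Comparison of the three tensors phi_a o nabla xi_a *)

Variables (nabla : V -> V -> V) (c : R).
Hypothesis nablaP : levi_civita g nabla.
Hypothesis lie_xi : forall s : 'S_3, ~~ odd_perm s ->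
  lie (xi (s 0)) (xi (s 1)) = (c%:A : C) *: xi (s 2).
Local Notation gP := tqs_metric.
Local Notation gE := (metricE gP).
Local Notation S a X := (nabla X (xi a)).
Local Notation k := ((c / 2)%:A : C).

Lemma metric_xi a X : g X (xi a) = eta a X.
Proof. by rewrite (eta_metric (tqs_acm a)). Qed.

Lemma etaE a : (eta a (xi a) = 1) * (forall X, eta a (phi a X) = 0)
  * (forall X, eta a (S a X) = 0).
Proof.
split; first by split; [exact: eta_xi (tqs_acm a)|exact: eta_phi (tqs_acm a)].
by move=> X; rewrite -metric_xi (nabla_xi_xi nablaP (tqs_qs a)).
Qed.

Lemma half_lie_constD : k + k = c%:A.
Proof. by rewrite -scalerDl -splitr. Qed.

(** Obtained by differentiating phi_{a+2} = phi_a phi_{a+1} - eta_{a+1} xi_a along [X] and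
    evaluating on xi_{a+2}, which phi_{a+1} sends to xi_a. *)
Lemma phi_nabla_xi_succ2 a X : phi (a + 2) (S (a + 2) X) = phi a (S a X)
  - eta (a + 2) (phi (a + 1) (S (a + 1) X)) *: xi (a + 2)
  + eta a (phi (a + 1) (S (a + 1) X)) *: xi a.
Proof.
have E Y : phi (a + 2) Y = phi a (phi (a + 1) Y) - eta (a + 1) Y *: xi a.
  by rewrite phi_phi addrK.
have etaD Y : (X (eta (a + 1) Y) : C)
    = eta (a + 1) (nabla X Y) + g Y (S (a + 1) X).
  by rewrite -!metric_xi (nabla_metric nablaP).
have xi2 : phi (a + 1) (xi (a + 2)) = xi a.
  by have := phi_xi_succ (a + 1); rewrite !ord3_add.
have : cov nabla (phi (a + 2)) X (xi (a + 2)) =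
    cov nabla (phi a) X (phi (a + 1) (xi (a + 2)))
    + phi a (cov nabla (phi (a + 1)) X (xi (a + 2)))
    - g (xi (a + 2)) (S (a + 1) X) *: xi a
    - eta (a + 1) (xi (a + 2)) *: S a X.
  rewrite !covE !E (nablaDr nablaP) (nablaNr nablaP) (nablaZr nablaP) etaD.
  rewrite [phi a (_ - _)]linearB /=.
  by apply: (metric_inj gP) => Z; rewrite !gE; ring.
rewrite xi2 !(cov_phi_xi nablaP (tqs_qs _)) (cov_phi nablaP (tqs_qs _)).
have /= := eta_xi_succ (a + 1); rewrite !ord3_add => ->.
rewrite !scale0r !subr0 linearZ /= phi_xi_succ metric_xi.
have -> : g (xi (a + 2)) (S (a + 1) X) = eta a (phi (a + 1) (S (a + 1) X)).
  rewrite -metric_xi (phi_skew (tqs_acm (a + 1))) phi_xi_pred.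
  by rewrite (metricC gP) !gE opprK.
move=> /(congr1 -%R); rewrite opprK => ->.
by apply: (metric_inj gP) => Z; rewrite !gE; ring.
Qed.

Lemma eta_phi_nabla_xi a X :
  eta a (phi (a + 1) (S (a + 1) X)) = eta a (phi (a + 2) (S (a + 2) X)).
Proof.
rewrite (phi_nabla_xi_succ2 a) !(raddfD, raddfN) /= !linearZ /= !etaE.
have := eta_xi_pred (a + 2); rewrite !ord3_add => ->; ring.
Qed.

Lemma phi_nabla_xi_sym a X Y : g (phi a (S a X)) Y = g X (phi a (S a Y)).
Proof. exact: (metric_phi_nabla_xi nablaP (tqs_qs a)). Qed.

Lemma phi_nabla_xi_self a : phi a (S a (xi a)) = 0.
Proof. by rewrite (nabla_xi_self nablaP (tqs_qs a)) linear0. Qed.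

Lemma phi_phi_nabla_xi a X : S a X = - phi a (phi a (S a X)).
Proof. by rewrite (phiK (tqs_acm a)) etaE scale0r addr0 opprK. Qed.

Lemma phi_nabla_xi_eigen a : let f := eta a (phi (a + 1) (S (a + 1) (xi a))) in
  phi (a + 1) (S (a + 1) (xi a)) = f *: xi a /\
  phi (a + 2) (S (a + 2) (xi a)) = f *: xi a.
Proof.
have E2 : phi (a + 2) (S (a + 2) (xi a)) =
    eta a (phi (a + 1) (S (a + 1) (xi a))) *: xi a.
  rewrite phi_nabla_xi_succ2 phi_nabla_xi_self sub0r.
  have := eta_phi_nabla_xi (a + 2) (xi a); rewrite !ord3_add => <-.
  by rewrite phi_nabla_xi_self raddf0 scale0r oppr0 add0r.
split=> //=; rewrite -E2; apply: (metric_inj gP) => Y.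
rewrite !phi_nabla_xi_sym -!(metricC gP (phi _ _)) !metric_xi.
exact: eta_phi_nabla_xi.
Qed.

Lemma lie_xiE a : lie (xi a) (xi (a + 1)) = (c%:A : C) *: xi (a + 2).
Proof. by have [s [/lie_xi + <- <- <-]] := even_perm_cyclic a. Qed.

Lemma phi_nabla_xi_xi a : phi (a + 1) (S (a + 1) (xi a)) = k *: xi a /\
  phi (a + 2) (S (a + 2) (xi a)) = k *: xi a.
Proof.
pose f b := eta b (phi (b + 1) (S (b + 1) (xi b))).
(* Expand [xi_b, xi_{b+1}] = c xi_{b+2} with the eigenvalue relations and read off the xi_{b+2}
   component. *)
have fD b : f b + f (b + 1) = c%:A.
  have [E1 _] := phi_nabla_xi_eigen b.
  have [_ E2] := phi_nabla_xi_eigen (b + 1); rewrite !ord3_add in E2.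
  have := lie_xiE b; rewrite (nablaB nablaP) (phi_phi_nabla_xi (b + 1)).
  rewrite (phi_phi_nabla_xi b) E1 E2 !linearZ /= phi_xi_succ phi_xi_pred.
  rewrite !opprK -scalerDl => /(congr1 (eta (b + 2))).
  by rewrite !linearZ /= etaE !mulr1 /f !ord3_add.
have -> : k = f a; last exact: phi_nabla_xi_eigen a.
(* The sums of neighbouring eigenvalues around the cycle all equal c, so each eigenvalue is c/2. *)
have := fD a; have := fD (a + 1); have := fD (a + 2); rewrite !ord3_add.
rewrite -half_lie_constD => E1 E2 E3.
apply/eqP; rewrite -subr_eq0; apply/eqP/smoothfun_addrr_eq0.
transitivity ((k + k) - (k + k) + (k + k) - (f a + f a)); first by ring.
by rewrite -{1}E1 -{1}E2 -E3; ring.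
Qed.

(** * The common tensor A *)

Local Notation shape := (shape nabla phi xi eta k).

(** By self-adjointness the coefficients in [phi_nabla_xi_succ2] are k eta_{b+2} and k eta_b, so the
    added Reeb term absorbs them. Steps of 2 from the index 0 reach every index. *)
Lemma shapeE a X : shape X = phi a (S a X) + (k * eta a X) *: xi a.
Proof.
have step b : phi (b + 2) (S (b + 2) X) + (k * eta (b + 2) X) *: xi (b + 2) =
    phi b (S b X) + (k * eta b X) *: xi b.
  have etak d' e : phi e (S e (xi d')) = k *: xi d' ->
      eta d' (phi e (S e X)) = k * eta d' X.
    by move=> E; rewrite -metric_xi phi_nabla_xi_sym E !gE metric_xi.
  have [Eb _] := phi_nabla_xi_xi b; have [_ Eb2] := phi_nabla_xi_xi (b + 2).
  rewrite !ord3_add in Eb2.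
  rewrite phi_nabla_xi_succ2 (etak _ _ Eb) (etak _ _ Eb2).
  by apply: (metric_inj gP) => Z; rewrite !gE; ring.
rewrite shape.unlock; have F0 := step 0; have F2 := step 2; rewrite add0r in F0.
have [->|->|->] : [\/ a = 0, a = 2 | a = 2 + 2].
- by case: a => -[|[|[|//]]] lta;
    [apply: Or31|apply: Or33|apply: Or32]; apply/val_inj.
- by [].
- by rewrite F0.
- by rewrite F2 F0.
Qed.

Lemma shape_sym X Y : g (shape X) Y = g X (shape Y).
Proof.
rewrite (shapeE 0) (shapeE 0 Y) !gE phi_nabla_xi_sym (metricC gP (xi 0)).
rewrite !metric_xi; ring.
Qed.

Lemma shape_xi a : shape (xi a) = k *: xi a.
Proof.
by rewrite (shapeE a) phi_nabla_xi_self !etaE mulr1 add0r.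
Qed.

Lemma eta_shape a X : eta a (shape X) = k * eta a X.
Proof. by rewrite -!metric_xi shape_sym shape_xi gE. Qed.

Lemma nabla_xiE a X : S a X = - phi a (shape X).
Proof.
rewrite phi_phi_nabla_xi (shapeE a).
rewrite [phi a (_ + _)]linearD [phi a (_ *: _)]linearZ /=.
by rewrite (phi_xi (tqs_acm a)) scaler0 addr0.
Qed.

Lemma shape_phi a X : shape (phi a X) = phi a (shape X).
Proof.
rewrite !(shapeE a) [phi a (_ + _)]linearD [phi a (_ *: _)]linearZ /=.
rewrite (phi_xi (tqs_acm a)) (nabla_xi_phi nablaP (tqs_qs a)) !etaE.
by rewrite mulr0 scale0r scaler0.
Qed.

Lemma cov_phi_shape a X Y :
  cov nabla (phi a) X Y = g (shape X) Y *: xi a - eta a Y *: shape X.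
Proof.
rewrite (cov_phi nablaP (tqs_qs a)) (shapeE a).
apply: (metric_inj gP) => Z; rewrite !gE (metricC gP (xi a) Y) metric_xi.
ring.
Qed.

(** * The covariant derivative of A and the vanishing of B *)

Local Notation D := (cov nabla shape).
Local Notation B := (defect k shape).

Lemma defect_sym X Y : g (B X) Y = g X (B Y).
Proof. by rewrite defect.unlock !gE !shape_sym. Qed.

Lemma defect_xi a : B (xi a) = 0.
Proof.
rewrite defect.unlock shape_xi (self_adjointZ gP _ _ shape_sym) shape_xi.
by rewrite subrr.
Qed.

Lemma eta_defect a X : eta a (B X) = 0.
Proof. by rewrite -metric_xi defect_sym defect_xi (metric0r gP). Qed.

Lemma defect_phi a X : B (phi a X) = phi a (B X).
Proof.
rewrite defect.unlock !shape_phi.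
by rewrite [phi a (_ - _)]linearB [phi a (_ *: _)]linearZ.
Qed.

Lemma cov_shape_sym X Y Z : g (D X Y) Z = g Y (D X Z).
Proof. exact: (cov_self_adjoint gP nablaP X Y Z shape_sym). Qed.

(** As k is constant, differentiating A xi_a = k xi_a gives - k phi_a A X + A phi_a A X. *)
Lemma cov_shape_xi a X : D X (xi a) = phi a (B X).
Proof.
rewrite covE shape_xi (nablaZr nablaP) vfield_cst scale0r add0r.
rewrite !nabla_xiE defect.unlock.
rewrite [phi a (_ - _)]linearB [phi a (_ *: _)]linearZ /=.
rewrite -!shape_phi.
have -> : shape (- shape (phi a X)) = - shape (shape (phi a X)).
  by rewrite -scaleN1r (self_adjointZ gP _ _ shape_sym) scaleN1r.
by apply: (metric_inj gP) => Z; rewrite !gE; ring.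
Qed.

Lemma eta_cov_shape a X Y : eta a (D X Y) = g Y (phi a (B X)).
Proof. by rewrite -metric_xi cov_shape_sym cov_shape_xi. Qed.

(** The covariant derivative of A phi_a = phi_a A, with that of phi_a given by [cov_phi_shape]. *)
Lemma cov_shape_phi a X Y :
  D X (phi a Y) = phi a (D X Y) + g (B X) Y *: xi a + eta a Y *: B X.
Proof.
have phiD Z : nabla X (phi a Z) =
    phi a (nabla X Z) + (g (shape X) Z *: xi a - eta a Z *: shape X).
  by rewrite -cov_phi_shape covE addrC subrK.
rewrite !covE shape_phi !phiD !(self_adjointD gP _ _ shape_sym).
rewrite shape_phi !(self_adjointZ gP _ _ shape_sym) shape_xi eta_shape.
rewrite defect.unlock [phi a (_ - _)]linearB /=.
apply: (metric_inj gP) => Z; rewrite !gE (shape_sym (- _)) !gE.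
by rewrite !(shape_sym (shape X)); ring.
Qed.

Lemma cov_nabla_xi a X Y : cov nabla (nabla^~ (xi a)) X Y =
  - phi a (D X Y) - g (shape X) (shape Y) *: xi a
  + (k * eta a Y) *: shape X.
Proof.
rewrite covE !nabla_xiE (nablaNr nablaP).
rewrite -[nabla X (phi a _)](subrK (phi a (nabla X (shape Y)))).
rewrite -covE cov_phi_shape eta_shape covE [phi a (_ - _)]linearB /=.
by apply: (metric_inj gP) => Z; rewrite !gE; ring.
Qed.

(** This is d(d eta_a) = 0 for nabla xi_a = - phi_a A; the terms quadratic in A and those with
    factor k combine into B. *)
Lemma cov_shape_cyclic a X Y Z :
  g (phi a (D X Y)) Z + g (phi a (D Y Z)) X + g (phi a (D Z X)) Y
  + (eta a Z * g (B X) Y + eta a X * g (B Y) Z + eta a Y * g (B Z) X) = 0.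
Proof.
have := cov_nabla_xi_cyclic nablaP (tqs_qs a) X Y Z.
rewrite !cov_nabla_xi !gE !(metricC gP (xi a)) !metric_xi => /eqP.
rewrite -oppr_eq0 => /eqP E; rewrite -[RHS]E defect.unlock !gE.
have symE U W : g (shape U) W = g (shape W) U by rewrite shape_sym (metricC gP).
rewrite !(shape_sym (shape _)) (symE Z X) (symE Y X) (symE Z Y); ring.
Qed.

Lemma phi_ker a X : phi a X = 0 -> X = eta a X *: xi a.
Proof.
move=> pX; apply/esym/eqP; rewrite -subr_eq0 addrC -(phiK (tqs_acm a)) pX.
by rewrite linear0.
Qed.

(** In the cyclic identity at Z = xi_a the two terms in B cancel by symmetry, leaving phi_a
    (D_{xi_a} X) = 0. *)
Lemma cov_shape_xi_l a X : D (xi a) X = 0.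
Proof.
have pD : phi a (D (xi a) X) = 0.
  apply: (metric_inj gP) => Y; have := cov_shape_cyclic a X Y (xi a).
  rewrite cov_shape_xi (phiK (tqs_acm a)) !metric_xi !eta_defect defect_xi.
  rewrite !etaE !gE => E; rewrite -[RHS]E (defect_sym X) (metricC gP X).
  by ring.
rewrite (phi_ker pD) eta_cov_shape defect_xi linear0.
by rewrite (metric0r gP) scale0r.
Qed.

(** In the cyclic identity for index 0 at Z = xi_1, the first two terms both reduce to - g(phi_2 B
    X, Y), because phi_2 B is skew, and all others vanish. *)
Lemma defect0 X : B X = 0.
Proof.
suff /phi_ker -> : phi (0 + 2) (B X) = 0 by rewrite eta_defect scale0r.
apply: (metric_inj gP) => Y; rewrite (metric0l gP).
apply: smoothfun_addrr_eq0; have := cov_shape_cyclic 0 X Y (xi (0 + 1)).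
rewrite (phi_skew (tqs_acm 0)) phi_xi_succ metric_xi eta_cov_shape.
rewrite cov_shape_xi phi_phi eta_defect cov_shape_xi_l linear0 !metric_xi.
rewrite !eta_defect defect_xi eta_xi_succ !gE.
have -> : g (phi (0 + 2) (B Y)) X = - g (phi (0 + 2) (B X)) Y.
  by rewrite (phi_skew (tqs_acm _)) defect_sym defect_phi (metricC gP).
by rewrite (metricC gP Y) => E; rewrite -[RHS]oppr0 -[in RHS]E; ring.
Qed.

Lemma cov_shape_phi0 a X Y : D X (phi a Y) = phi a (D X Y).
Proof.
by rewrite cov_shape_phi !defect0 (metric0l gP) scale0r scaler0 !addr0.
Qed.

Lemma eta_cov_shape0 a X Y : eta a (D X Y) = 0.
Proof. by rewrite eta_cov_shape defect0 linear0 (metric0r gP). Qed.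

Lemma shapeK X : shape (shape X) = k *: shape X.
Proof.
by have := defect0 X; rewrite defect.unlock => /eqP; rewrite subr_eq0 => /eqP.
Qed.

(** * The Codazzi equation for A and the curvature *)

Local Notation T X Y := (D X Y - D Y X).

Lemma eta_alt_cov_shape a X Y : eta a (T X Y) = 0.
Proof. by rewrite raddfB /= !eta_cov_shape0 subrr. Qed.

Lemma alt_cov_shape a X Y Z : g (phi a (T X Y)) Z = - g (phi a (D Z X)) Y.
Proof.
have := cov_shape_cyclic a X Y Z; rewrite !defect0 !gE !mulr0 !addr0 => /eqP.
rewrite addr_eq0 => /eqP <-; rewrite [phi a (_ - _)]linearB /= !gE.
congr (_ + _); rewrite (phi_skew (tqs_acm a) _ X) cov_shape_sym cov_shape_phi0.
by rewrite (metricC gP Z).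
Qed.

Lemma alt_cov_shape_phi a X Y : T X (phi a Y) = phi a (T X Y).
Proof.
suff step b : T X (phi (b + 1) Y) = phi (b + 1) (T X Y).
  by have := step (a + 2); rewrite !ord3_add.
(* On the right of [alt_cov_shape] the argument [Y] occurs undifferentiated, so phi_{b+1} moves
   across the metric and meets phi_b. *)
have pT : phi b (T X (phi (b + 1) Y)) = phi (b + 2) (T X Y).
  apply: (metric_inj gP) => Z; rewrite !alt_cov_shape.
  rewrite -(phi_skew (tqs_acm (b + 1))) phi_phi_rev eta_cov_shape0.
  by rewrite scale0r addr0 !gE.
have := congr1 (phi b) pT; rewrite (phiK (tqs_acm b)) eta_alt_cov_shape.
rewrite scale0r addr0; have := phi_phi_rev (b + 2) (T X Y).
rewrite !ord3_add => ->.
rewrite eta_alt_cov_shape scale0r addr0; exact: oppr_inj.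
Qed.

Lemma cov_shape_codazzi X Y : D X Y = D Y X.
Proof.
have skew U W : T U W = - T W U by rewrite opprB.
have phil a U W : T (phi a U) W = phi a (T U W).
  by rewrite skew alt_cov_shape_phi -linearN -skew.
(* Pulling phi_0 and phi_1 out of T in both orders gives phi_0 phi_1 T = phi_1 phi_0 T, that is
   phi_2 T = - phi_2 T. *)
have E := alt_cov_shape_phi (0 + 1) (phi 0 X) Y.
rewrite !phil alt_cov_shape_phi phi_phi phi_phi_rev !eta_alt_cov_shape in E.
rewrite !scale0r !addr0 in E.
have /phi_ker : phi (0 + 2) (T X Y) = 0.
  apply: (metric_inj gP) => Z; rewrite (metric0l gP).
  by apply: smoothfun_addrr_eq0; rewrite [in X in X + _]E !gE addNr.
by rewrite eta_alt_cov_shape scale0r => /eqP; rewrite subr_eq0 => /eqP.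
Qed.

(** The curvature is the alternation of the second covariant derivative of xi_a. By Codazzi only the
    term (k eta_a(Y)) A X of [cov_nabla_xi] survives it. *)
Lemma curvature_xi a X Y : curvature nabla X Y (xi a) =
  k *: (eta a Y *: shape X - eta a X *: shape Y).
Proof.
have -> : curvature nabla X Y (xi a) =
    cov nabla (nabla^~ (xi a)) X Y - cov nabla (nabla^~ (xi a)) Y X.
  rewrite !covE /curvature (nablaB nablaP) (nablaDl nablaP) (nablaNl nablaP).
  by apply: (metric_inj gP) => Z; rewrite !gE; ring.
rewrite !cov_nabla_xi cov_shape_codazzi (metricC gP (shape Y)).
by apply: (metric_inj gP) => Z; rewrite !gE; ring.
Qed.

(** * Identification of psi_a for c nonzero *)

Local Notation k' := ((c / 2)^-1%:A : C).

Lemma mul_half_lie_constV : c != 0 -> k' * k = 1.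
Proof.
move=> c0; rewrite mulr_algl scalerA mulVf ?scale1r//.
by rewrite mulf_neq0 ?invr_eq0 ?pnatr_eq0.
Qed.

Lemma psiE (psi : 'I_3 -> {linear V -> V}) a X : c != 0 ->
  is_psi g phi eta psi -> psi a X = k' *: phi a (shape X).
Proof.
move=> c0 /(_ a)[psi_phi psi0]; have kk' := mul_half_lie_constV c0.
(* Here d eta_a(Y, .) = 0 says phi_a A Y = 0, so A Y is a multiple of xi_a, with coefficient k
   eta_a(Y) = 0. *)
have E4m0 Y : E4m eta Y -> shape Y = 0.
  move=> [eta0 deta0]; have/phi_ker -> : phi a (shape Y) = 0.
    apply: (metric_inj gP) => Z; rewrite (metric0l gP).
    apply: smoothfun_addrr_eq0; have := deta0 a Z.
    rewrite (dform1_qs nablaP (tqs_qs a)) nabla_xiE !gE => E.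
    by rewrite -[RHS]oppr0 -[in RHS]E; ring.
  by rewrite eta_shape eta0 mulr0 scale0r.
(* By [shapeK], A/k is a self-adjoint projection; [P] is the component of [X] in E^{4l+3} and
   [X - P] that in E^{4m}. *)
pose P := k' *: shape X.
have P_E4l3 : E4l3 g eta P.
  by move=> Y /E4m0 Y0; rewrite /P !gE shape_sym Y0 (metric0r gP) mulr0.
have Q_E4m : E4m eta (X - P).
  have shapeQ : shape (X - P) = 0.
    apply: (metric_inj gP) => Z; rewrite /P shape_sym !gE.
    rewrite -(shape_sym (shape X)) shapeK !gE mulrA kk' mul1r shape_sym.
    by rewrite subrr.
  split=> [b|b Y].
    rewrite /P raddfB /= linearZ /= eta_shape mulrA kk' mul1r subrr//.
  rewrite (dform1_qs nablaP (tqs_qs b)) nabla_xiE shapeQ linear0.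
  by rewrite oppr0 (metric0l gP) addr0.
rewrite -[in LHS](subrK P X) addrC linearD /= (psi_phi _ P_E4l3) (psi0 _ Q_E4m).
by rewrite addr0 /P linearZ.
Qed.

Lemma curvature_xi_psi (psi : 'I_3 -> {linear V -> V}) a X Y :
  is_psi g phi eta psi ->
  curvature nabla X Y (xi a) = ((c ^+ 2 / 4)%:A : C) *:
    (eta a X *: psi a (psi a Y) - eta a Y *: psi a (psi a X)).
Proof.
move=> psiP; rewrite curvature_xi; have [c0|c0] := eqVneq c 0.
  by rewrite c0 expr0n !mul0r !scale0r.
have k2 : (c ^+ 2 / 4)%:A = k * k :> C.
  rewrite mulr_algl scalerA; congr (_ *: _).
  by rewrite mulf_div -natrM -expr2.
(* Commutation and A^2 = k A give psi_a^2 = k^-1 phi_a^2 A; the factor k clears the inverse. The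
   Reeb terms cancel in the final alternation. *)
have psi2 Z : k *: psi a (psi a Z) = (k * eta a Z) *: xi a - shape Z.
  rewrite !(psiE _ _ c0 psiP).
  rewrite (self_adjointZ gP _ _ shape_sym) shape_phi shapeK.
  rewrite ![phi a (_ *: _)]linearZ /= (phiK (tqs_acm a)) eta_shape.
  have kk' := mul_half_lie_constV c0.
  by rewrite !scalerA (mulrC k k') kk' mulr1 scale1r addrC.
rewrite k2.
apply: (metric_inj gP) => Z; rewrite !gE.
have := congr1 (g^~ Z) (psi2 X); have := congr1 (g^~ Z) (psi2 Y).
rewrite /= !gE => E1 E2.
transitivity (k * (eta a X * (k * g (psi a (psi a Y)) Z)
  - eta a Y * (k * g (psi a (psi a X)) Z))); last by ring.
by rewrite E1 E2; ring.
Qed.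

End ThreeStructure.

(** * The case of rank 1 *)

Lemma rank1_dform1 (R : realType) (d : nat) (M : manifold R d)
    (eta : {scalar vfield M}) X Y :
  has_rank eta 1 -> dform1 eta X Y = 0.
Proof.
(* Rank 1 forces p = 0, so the wedge of d eta with the 0-form 1 vanishes. Its sum over the two
   permutations of ['I_2] is d eta(X, Y) - d eta(Y, X), twice d eta(X, Y). *)
case=> -[|p] [rE _ w0]; last by move: rE; rewrite mulnS addn1.
have dC : dform1 eta Y X = - dform1 eta X Y.
  by rewrite /dform1 lieC raddfN /=; ring.
have := w0 (fun i => if i == ord0 then X else Y).
rewrite /= /wedge /form2.
have t01 : tperm (ord0 : 'I_2) ord_max != 1%g.
  by apply/eqP => /permP/(_ ord0); rewrite tpermL perm1.
have S2 (s : 'S_2) : s != 1%g -> s = tperm ord0 ord_max.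
  have ord2 (i : 'I_2) : i = ord0 \/ i = ord_max.
    by case: i => -[|[|//]] lti; [left|right]; apply/val_inj.
  move=> s1; have s0 : s ord0 = ord_max.
    have [s0|//] := ord2 (s ord0); case/eqP: s1; apply/permP => i.
    rewrite perm1; have [->//|->] := ord2 i; have [sm|//] := ord2 (s ord_max).
    by have := @perm_inj _ s ord0 ord_max; rewrite s0 sm => /(_ erefl).
  have sm : s ord_max = ord0.
    have [//|sm] := ord2 (s ord_max).
    by have := @perm_inj _ s ord0 ord_max; rewrite s0 sm => /(_ erefl).
  by apply/permP => i; have [->|->] := ord2 i; rewrite ?tpermL ?tpermR.
rewrite (bigD1 1%g)//= (bigD1 (tperm ord0 ord_max))//= big1; last first.
  by move=> s /andP[/S2 -> /eqP].
have lshift2 (i : 'I_2) : lshift (0 * 2) i = i by apply/val_inj.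
rewrite odd_perm1 odd_tperm /= !perm1 !lshift2 tpermL tpermR /= dC.
rewrite expr0 expr1 !mulr1 mul1r mulN1r opprK addr0 => /eqP.
rewrite scaler_eq0 invr_eq0 pnatr_eq0 /= => /eqP.
exact: smoothfun_addrr_eq0.
Qed.

Theorem theorem3p4 (R : realType) (n : nat) (M : manifold R (4 * n + 3))
    (g : vfield M -> vfield M -> smoothfun M)
    (phi : 'I_3 -> {linear vfield M -> vfield M})
    (xi : 'I_3 -> vfield M)
    (eta : 'I_3 -> {scalar vfield M})
    (nabla : vfield M -> vfield M -> vfield M)
    (c : R) :
  three_quasi_sasakian g phi xi eta ->
  levi_civita g nabla ->
  (forall s : 'S_3, ~~ odd_perm s ->
     lie (xi (s 0)) (xi (s 1)) = (c%:A : smoothfun M) *: xi (s 2)) ->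
  (three_qs_rank eta 1 ->
     forall (a : 'I_3) (X Y : vfield M), curvature nabla X Y (xi a) = 0) /\
  (~ three_qs_rank eta 1 ->
     forall psi : 'I_3 -> {linear vfield M -> vfield M},
     is_psi g phi eta psi ->
     forall (a : 'I_3) (X Y : vfield M),
       curvature nabla X Y (xi a) =
         ((c ^+ 2 / 4)%:A : smoothfun M) *:
           (eta a X *: psi a (psi a Y) - eta a Y *: psi a (psi a X))).
Proof.
move=> tqs nablaP lie_xi; split=> [rank1 a X Y|_ psi psiP a X Y].
  (* Since d eta_a is twice g(nabla xi_a, .), its vanishing makes xi_a parallel. *)
  have nabla_xi0 Z : nabla Z (xi a) = 0.
    apply: (metric_inj (tqs_metric tqs)) => W.
    rewrite (metric0l (tqs_metric tqs)); apply: smoothfun_addrr_eq0.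
    by rewrite -(dform1_qs nablaP (tqs_qs tqs a)) rank1_dform1.
  by rewrite /curvature !nabla_xi0 !(nabla0r nablaP) !subr0.
exact: (curvature_xi_psi tqs nablaP lie_xi a X Y psiP).
Qed.
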